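(* Let $d\ge 2$ be an integer. A Moore graph of diameter $2$ and degree $d$ exists if and only if there exists a graph $H$ with the following properties: (i) the vertex set of $H$ is partitioned into $d$ parts, with no edges inside a part ($H$ is $d$-partite with respect to this partition); (ii) each part has exactly $d-1$ vertices; (iii) every vertex of $H$ has degree $d-1$; (iv) each vertex in one part is adjacent to exactly one vertex in each other part; (v) $H$ contains no triangles and no cycles of length $4$.
   Context: A Moore graph of diameter 2 and degree $d$ is a $d$-regular graph of diameter $2$ and girth $5$; equivalently a $d$-regular graph of diameter $2$ on $d^2+1$ vertices. *)

(* Defs.v *)
From mathcomp Require Import all_boot.

Set Implicit Arguments.
Unset Strict Implicit.
Unset Printing Implicit Defensive.

Record sgraph := SGraph {
  vertex :> finType;
  adj : rel vertex;
  adj_sym : symmetric adj;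
  adj_irrefl : irreflexive adj
}.

Section Graph.
Variable G : sgraph.
Implicit Types (x y : G) (c p : seq G).

Definition degree x : nat := #|[set y | adj x y]|.

Definition regular (d : nat) : Prop := forall x, degree x = d.

(* The vertices of the walk are x :: p, so its length is size p. *)
Definition walk x y p : Prop := path (@adj G) x p /\ last x p = y.

Definition has_distance x y (k : nat) : Prop :=
  (exists2 p, walk x y p & size p = k) /\
  (forall p, walk x y p -> k <= size p).

(* The first conjunct implies that G is connected, the second that G is
   nonempty. *)
Definition has_diameter (k : nat) : Prop :=
  (forall x y, exists2 m, has_distance x y m & m <= k) /\
  (exists x y, has_distance x y k).

(* c lists the vertices in cyclic order, without repeating the first one, so
   the length of the cycle is size c.  The bound excludes an edge traversed
   back and forth, which satisfies ucycle. *)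
Definition graph_cycle c : Prop := ucycle (@adj G) c /\ 3 <= size c.

Definition has_girth (g : nat) : Prop :=
  (exists2 c, graph_cycle c & size c = g) /\
  (forall c, graph_cycle c -> g <= size c).

Definition Moore_graph2 (d : nat) : Prop :=
  [/\ regular d, has_diameter 2 & has_girth 5].

End Graph.

(* Main.v *)
(* In one direction, H consists of the vertices at distance 2 from a vertex r of
   the Moore graph, partitioned by their unique neighbor adjacent to r.
   Conversely, add to H a vertex for each part, joined to the elements of the
   part, and a root joined to these new vertices: the result is d-regular on
   d ^ 2 + 1 vertices without triangles or squares, and counting paths of length
   at most 2 then forces diameter 2, hence girth 5. *)

Require Import Defs.
From mathcomp Require Import all_boot zify.

Set Implicit Arguments.
Unset Strict Implicit.
Unset Printing Implicit Defensive.

(** * Triangles, squares, diameter 2 and girth 5 *)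

Section Graphs.
Variable G : sgraph.
Implicit Types x y z u v : G.

Definition triangle_free :=
  forall x y z, adj x y -> adj y z -> adj z x -> False.

(** The absence of 4-cycles, with [x], [y] and [u], [v] as the pairs of opposite corners; adjacency
    already makes consecutive corners distinct. *)
Definition square_free :=
  forall x y u v, x != y -> adj x u -> adj u y -> adj x v -> adj v y -> u = v.

Lemma adj_neq x y : adj x y -> x != y.
Proof. by apply: contraTneq => ->; rewrite adj_irrefl. Qed.

(** Translates the condition on cyclic sequences into the adjacency form used in all later
    arguments. *)
Lemma no_short_cycleP :
  (forall c : seq G, graph_cycle c -> size c <> 3 /\ size c <> 4) <->
  triangle_free /\ square_free.
Proof.
split=> [nc | [tf sf] c [/andP[]]].
  split=> [x y z xy yz zx | x y u v xNy xu uy xv vy].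
    have [] // := nc [:: x; y; z]; split=> //; rewrite /ucycle /= xy yz zx /=.
    by rewrite !inE negb_or (adj_neq xy) (adj_neq yz) eq_sym (adj_neq zx).
  apply/eqP/idPn => uNv; have [] // := nc [:: x; u; y; v]; split=> //.
  rewrite /ucycle /= xu uy (adj_sym y) vy (adj_sym v) xv /=.
  rewrite !inE !negb_or (adj_neq xu) xNy (adj_neq xv) (adj_neq uy) uNv.
  by rewrite eq_sym (adj_neq vy).
case: c => [|x [|y [|z [|t [|? ?]]]]] //=; rewrite ?andbT.
  by move=> /and3P[xy yz zx] _ _; case: (tf _ _ _ xy yz zx).
case/and4P=> xy yz zt tx; rewrite !inE !negb_or.
case/and3P=> /and3P[_ xNz _] /andP[_ yNt] _ _; case/eqP: yNt.
by apply: (sf x z); rewrite // adj_sym.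
Qed.

Lemma diameter2_common x y :
  has_diameter G 2 -> x != y -> ~~ adj x y -> exists z, adj x z /\ adj z y.
Proof.
case=> /(_ x y)[m [[p [xp lp] <-] _] sz] _ xNy nxy.
case: p xp lp sz => [|z [|t [|? ?]]] //=.
- by move=> _ xy; rewrite xy eqxx in xNy.
- by rewrite andbT => xz zy; rewrite -zy xz in nxy.
by case/and3P=> xz zt _ ty _; exists z; rewrite -ty.
Qed.

Lemma girth5_free : has_girth G 5 -> triangle_free /\ square_free.
Proof. by case=> _ g5; apply/no_short_cycleP => c /g5; lia. Qed.

Lemma degree_gt1_neighbor x y :
  1 < degree x -> exists2 z, z != y & adj x z.
Proof.
case: (pickP [pred z | (z != y) && adj x z]) => [z /andP[] | none].
  by exists z.
rewrite ltnNge -(cards1 y) subset_leq_card //; apply/subsetP => z.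
by rewrite !inE => xz; have /= := none z; rewrite xz andbT => /negbFE.
Qed.

(** Excluding triangles and squares bounds the girth below by 5, so what remains is to exhibit a
    pair at distance 2 and a pentagon. The vertex [x0] is where both constructions start. *)
Lemma Moore_graph2_free d (x0 : G) :
    2 <= d -> regular G d -> triangle_free -> square_free ->
    (forall x y, x != y -> ~~ adj x y -> exists z, adj x z /\ adj z y) ->
  Moore_graph2 G d.
Proof.
move=> d2 reg tf sf diam.
have nbr x y : exists2 z, z != y & adj x z.
  by apply: degree_gt1_neighbor; rewrite reg.
(* Two neighbors of [x0], nonadjacent for lack of triangles: they realize distance 2. *)
have [y _ xy] := nbr x0 x0; have [a aNy xa] := nbr x0 y.
have nay : ~~ adj a y.
  by apply/negP => ay; apply: (tf x0 a y); rewrite // adj_sym.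
have dist2 u v : u != v -> ~~ adj u v -> has_distance u v 2.
  move=> uNv nuv; split=> [|p [pp]].
    have [z [uz zv]] := diam _ _ uNv nuv.
    by exists [:: z; v] => //; split; rewrite //= uz zv.
  case: p pp => [|z [|? ?]] //=; first by move=> _ /eqP; rewrite (negPf uNv).
  by rewrite andbT => uz zv; rewrite -zv uz in nuv.
split=> //.
  split=> [u v|]; last by exists a, y; apply: dist2.
  have [-> | uNv] := eqVneq u v; first by exists 0 => //; split=> //; exists [::].
  have [uv | nuv] := boolP (adj u v); last by exists 2; first exact: dist2.
  exists 1 => //; split=> [|[|//] [_ /= /eqP]]; last by rewrite (negPf uNv).
  by exists [:: v] => //; split; rewrite //= uv.
split=> [|c]; last first.
  move=> cc; have [_ /(_ (conj tf sf)) /(_ c cc)] := no_short_cycleP.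
  by case: cc; lia.
(* The path [a], [x0], [y], [b] is closed into a pentagon by a common neighbor [c] of [a] and [b];
   an edge from [a] to [b] would close a square instead. *)
have [b bNx yb] := nbr y x0.
have aNb : a != b.
  by apply: contraNneq nay => ->; rewrite adj_sym.
have nab : ~~ adj a b.
  apply/negP => ab; case/eqP: aNy; apply: (sf x0 b) => //.
  by rewrite eq_sym.
have [c [ac cb]] := diam a b aNb nab.
have cNx : c != x0.
  by apply/eqP => cx; apply: (tf x0 y b); rewrite // adj_sym -cx.
have cNy : c != y by apply: contraNneq nay => <-.
exists [:: a; x0; y; b; c] => //; split=> //.
rewrite /ucycle /= (adj_sym a) xa xy yb (adj_sym b) cb (adj_sym c) ac /=.
rewrite !inE !negb_or aNy aNb (adj_neq ac) (adj_neq xy) (adj_neq yb).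
rewrite (eq_sym a) (adj_neq xa) (eq_sym x0) bNx (eq_sym x0) cNx.
by rewrite (eq_sym y) cNy eq_sym (adj_neq cb).
Qed.

(** * Counting paths of length at most 2 *)

Lemma square_free_common x y :
  square_free -> x != y -> #|[set z | adj x z && adj z y]| <= 1.
Proof.
move=> sf xNy; apply/card_le1P => u; rewrite inE => /andP[xu uy] v.
rewrite !inE; apply/idP/eqP => [/andP[xv vy]|->]; last by rewrite xu uy.
exact: (sf x y).
Qed.

(* For fixed x, the sum over y <> x of [x ~ y] + |N(x) /\ N(y)| is
   d + d (d - 1) = d ^ 2; it has d ^ 2 terms, each at most 1. *)
Lemma regular_free_diameter d :
    regular G d -> triangle_free -> square_free -> #|G| = (d ^ 2).+1 ->
  forall x y, x != y -> ~~ adj x y -> exists z, adj x z /\ adj z y.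
Proof.
move=> reg tf sf cardG x y xNy nxy.
pose C v := #|[set z | adj x z && adj z v]|.
have le1 v : v != x -> adj x v + C v <= 1.
  rewrite eq_sym => xNv; case xv: (adj x v) => /=; last first.
    exact: square_free_common.
  rewrite (_ : C v = 0) //; apply: eq_card0 => z; rewrite !inE.
  by apply/negP => /andP[xz zv]; apply: (tf x z v); rewrite // adj_sym.
have sumC : \sum_v C v = d * d.
  (* Double counting of the walks [x], [z], [v]: there are [d] choices of [z], then [d] of [v]. *)
  rewrite (eq_bigr (fun v => \sum_(z | adj x z) adj z v)); last first.
    move=> v _; rewrite /C -sum1_card big_mkcond [RHS]big_mkcond /=.
    by apply: eq_bigr => z _; rewrite inE; case: (adj x z); case: (adj z v).
  rewrite exchange_big (eq_bigr (fun=> d)) /=; last first.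
    move=> z _; rewrite -(reg z) /degree -sum1_card [RHS]big_mkcond /=.
    by apply: eq_bigr => v _; rewrite inE; case: (adj z v).
  by rewrite sum_nat_const; congr (_ * _); rewrite -[RHS](reg x) /degree cardsE.
have sumadj : \sum_v adj x v = d.
  rewrite -[RHS](reg x) /degree -sum1_card [RHS]big_mkcond /=.
  by apply: eq_bigr => v _; rewrite inE; case: (adj x v).
have Cx : C x = d.
  rewrite -(reg x); apply: eq_card => z.
  by rewrite !inE (adj_sym z) andbb.
have sumS : \sum_(v | v != x) (adj x v + C v) = d ^ 2.
  have : \sum_v (adj x v + C v) = d + d * d by rewrite big_split /= sumadj sumC.
  by rewrite (bigD1 x) //= adj_irrefl Cx /=; lia.
have sum1 : \sum_(v | v != x) 1 = d ^ 2.
  rewrite sum1_card; have := cardC1 x; rewrite cardG /= => <-.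
  by apply: eq_card => v; rewrite !inE.
(* Every term is at most 1 and the two sums agree, so every term equals 1; at the nonadjacent vertex
   [y] the whole contribution comes from [C y]. *)
have [_ /esym] := leqif_sum (fun v vNx => leqif_geq (le1 v vNx)).
rewrite sumS sum1 eqxx => /forall_inP /(_ y).
rewrite eq_sym (negPf nxy) => /(_ xNy) /card_gt0P[z].
by rewrite inE => /andP[]; exists z.
Qed.

End Graphs.

(** * The graph on the vertices at distance 2 from a vertex [r] *)

Section SecondNeighborhood.
Variables (G : sgraph) (r : G) (d : nat).
Hypotheses (d_gt1 : 2 <= d) (reg : regular G d).
Hypotheses (tf : triangle_free G) (sf : square_free G).
Hypothesis diam :
  forall x y : G, x != y -> ~~ adj x y -> exists z, adj x z /\ adj z y.

(** Under the hypothesis [diam], being neither [r] nor a neighbor of [r] amounts to being at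
    distance 2 from [r]. *)
Definition second_nbr := {x : G | (x != r) && ~~ adj r x}.

Definition second_adj : rel second_nbr := fun x y => adj (val x) (val y).

Lemma second_adj_sym : symmetric second_adj.
Proof. by move=> x y; apply: adj_sym. Qed.

Lemma second_adj_irrefl : irreflexive second_adj.
Proof. by move=> x; apply: adj_irrefl. Qed.

Definition second_graph := SGraph second_adj_sym second_adj_irrefl.

Definition part (u : G) : {set second_graph} :=
  [set y : second_graph | adj u (val y)].

Definition parts := part @: [set u | adj r u].

Lemma in_second u v : adj r u -> adj u v -> v != r -> (v != r) && ~~ adj r v.
Proof.
move=> ru uv vNr; rewrite vNr; apply/negP => rv.
by apply: (tf ru uv); rewrite adj_sym.
Qed.

Lemma second_parent (x : second_graph) : exists2 u, adj r u & x \in part u.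
Proof.
have /andP[xNr nrx] := valP x.
have [|u [ru ux]] := diam _ nrx; first by rewrite eq_sym.
by exists u; rewrite ?inE.
Qed.

(** Otherwise [r], [u], [x], [v] would form a square. *)
Lemma part_inj_in u v (x : second_graph) :
  adj r u -> adj r v -> x \in part u -> x \in part v -> u = v.
Proof.
have /andP[xNr _] := valP x.
by rewrite !inE => ru rv ux vx; apply: (sf _ ru ux rv vx); rewrite eq_sym.
Qed.

(** Among the [d] neighbors of [u] only [r] is lost: the others are not adjacent to [r], for lack of
    triangles. *)
Lemma card_part u : adj r u -> #|part u| = d - 1.
Proof.
move=> ru; rewrite -(reg u) /degree (cardsD1 r) inE adj_sym ru /= add1n subn1 /=.
rewrite -(card_imset (part u) val_inj); apply: eq_card => v; rewrite !inE.
apply/imsetP/andP => [[x xu ->] | [vNr uv]].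
  by have /andP[-> _] := valP x; rewrite inE in xu.
by exists (Sub v (in_second ru uv vNr)); rewrite ?inE SubK.
Qed.

Lemma part_neq0 u : adj r u -> part u != set0.
Proof. by move=> ru; rewrite -card_gt0 card_part //; lia. Qed.

(** Parts of distinct neighbors of [r] are disjoint, and they are nonempty since [d] is at least 2,
    so distinct neighbors give distinct parts. *)
Lemma card_parts : #|parts| = d.
Proof.
rewrite card_in_imset ?(reg r : #|_| = d) // => u v.
rewrite !inE => ru rv uv; have /set0Pn[x xu] := part_neq0 ru.
by apply: (part_inj_in (x := x)); rewrite // -uv.
Qed.

Lemma partition_parts : partition parts [set: second_graph].
Proof.
apply/and3P; split.
- rewrite eqEsubset subsetT /=; apply/subsetP => x _.
  have [u ru xu] := second_parent x; apply/bigcupP; exists (part u) => //.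
  by apply: imset_f; rewrite inE.
- apply/trivIsetP => A B /imsetP[u]; rewrite inE => ru -> /imsetP[v].
  rewrite inE => rv -> uNv; apply/pred0P => x /=; apply/negP => /andP[xu xv].
  by rewrite (part_inj_in ru rv xu xv) eqxx in uNv.
apply/imsetP => -[u]; rewrite inE => ru /esym/eqP; exact/negP/part_neq0.
Qed.

Lemma part_independent u (x y : second_graph) :
  x \in part u -> y \in part u -> ~~ adj x y.
Proof.
rewrite !inE => ux uy; apply/negP => xy.
by apply: (tf ux xy); rewrite adj_sym.
Qed.

(** The match of [x] is its common neighbor with [v], which exists because [x], lying in another
    part, is not adjacent to [v]. A second match would close a square through [v] and [x]. *)
Lemma part_matching u v (x : second_graph) :
  adj r u -> adj r v -> part u != part v -> x \in part u ->
  exists! y : second_graph, y \in part v /\ adj x y.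
Proof.
move=> ru rv uNv xu; have /andP[xNr nrx] := valP x.
have nvx : ~~ adj v (val x).
  apply/negP => vx; case/eqP: uNv; congr part.
  by apply: part_inj_in ru rv xu _; rewrite inE.
have vNx : v != val x by apply: contraNneq nrx => <-.
have [y [vy yx]] := diam vNx nvx.
have yNr : y != r by apply: contraNneq nrx => yr; rewrite yr in yx.
exists (Sub y (in_second rv vy yNr)); split.
  by rewrite inE /= /second_adj /= (adj_sym (val x)).
move=> z [/[!inE] vz xz]; apply: val_inj; rewrite SubK.
by apply: (sf vNx); rewrite // adj_sym.
Qed.

(** The only neighbor of [x] lost is the [u] whose part contains [x]: another neighbor of [x]
    adjacent to [r] would form a square with [r], [u] and [x]. *)
Lemma second_regular : regular second_graph (d - 1).
Proof.
move=> x; have /andP[xNr nrx] := valP x.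
have [u ru] := second_parent x; rewrite inE => ux.
rewrite -(reg (val x)) /degree (cardsD1 u) inE adj_sym ux /= add1n subn1 /=.
rewrite -(card_imset _ val_inj); apply: eq_card => v; rewrite !inE.
apply/imsetP/andP => [[y xy ->] | [vNu xv]].
  rewrite inE in xy; split=> //; have /andP[_ nry] := valP y.
  by apply: contraNneq nry => ->.
have vNr : v != r by apply: contraNneq nrx => vr; rewrite adj_sym; rewrite vr in xv.
have vH : (v != r) && ~~ adj r v.
  rewrite vNr; apply: contra vNu => rv; apply/eqP.
  by apply: (@sf r (val x)); rewrite ?(eq_sym r) // adj_sym.
by exists (Sub v vH); rewrite ?inE.
Qed.

Lemma second_triangle_free : triangle_free second_graph.
Proof. by move=> x y z; apply: tf. Qed.

Lemma second_square_free : square_free second_graph.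
Proof.
by move=> x y u v xNy xu uy xv vy; apply: val_inj; apply: (sf _ xu uy xv vy).
Qed.

End SecondNeighborhood.

(** * The Moore graph built from a partitioned graph *)

Section Cone.
Variables (H : sgraph) (P : {set {set H}}) (d : nat).
Hypotheses (d_gt1 : 2 <= d) (partP : partition P [set: H]) (cardP : #|P| = d).
Hypothesis indep :
  forall A : {set H}, A \in P -> forall x y, x \in A -> y \in A -> ~~ adj x y.
Hypothesis card_block : forall A : {set H}, A \in P -> #|A| = d - 1.
Hypothesis reg : regular H (d - 1).
Hypothesis matching :
  forall A B : {set H}, A \in P -> B \in P -> A != B ->
  forall x, x \in A -> exists! y : H, y \in B /\ adj x y.
Hypotheses (tf : triangle_free H) (sf : square_free H).

(* [None] is a root joined to every block, and each block is joined to its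
   elements. *)
Definition cone := option ({A : {set H} | A \in P} + H)%type.

Definition cone_adj : rel cone := fun a b =>
  match a, b with
  | None, Some (inl _) | Some (inl _), None => true
  | Some (inl A), Some (inr x) | Some (inr x), Some (inl A) => x \in val A
  | Some (inr x), Some (inr y) => adj x y
  | _, _ => false
  end.

Lemma cone_adj_sym : symmetric cone_adj.
Proof. by move=> [[A|x]|] [[B|y]|] //=; apply: adj_sym. Qed.

Lemma cone_adj_irrefl : irreflexive cone_adj.
Proof. by move=> [[A|x]|] //=; apply: adj_irrefl. Qed.

Definition cone_graph := SGraph cone_adj_sym cone_adj_irrefl.

Let disj := partition_trivIset partP.

Lemma block_inj (A B : {A : {set H} | A \in P}) x :
  x \in val A -> x \in val B -> A = B.
Proof.
move=> xA xB; apply: val_inj.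
by rewrite -(def_pblock disj (valP A) xA) (def_pblock disj (valP B) xB).
Qed.

Lemma block_of x : exists A : {A : {set H} | A \in P}, x \in val A.
Proof.
have xP : x \in cover P by rewrite (cover_partition partP).
by exists (Sub (pblock P x) (pblock_mem xP)); rewrite SubK mem_pblock.
Qed.

(** By independence [x] lies outside the block [A], and the matching from the block of [x] to [A]
    gives it a single neighbor there. *)
Lemma block_nbr_inj (A : {A : {set H} | A \in P}) x y z :
  y \in val A -> z \in val A -> adj x y -> adj x z -> y = z.
Proof.
have [B xB] := block_of x => yA zA xy xz.
have BNA : val B != val A.
  by apply/eqP => BA; have := indep (valP A); rewrite -BA in yA * => /(_ x y xB yA) /negP.
have [t [_ tP]] := matching (valP B) (valP A) BNA xB.
by rewrite -(tP y) // -(tP z).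
Qed.

Lemma card_blocks : #|{: {A : {set H} | A \in P}}| = d.
Proof. by rewrite card_sig. Qed.

(** The root, the blocks and the vertices of [H] contribute 1 + d + d (d - 1). *)
Lemma card_cone : #|cone_graph| = (d ^ 2).+1.
Proof.
rewrite card_option card_sum card_blocks -cardsT (card_uniform_partition card_block partP).
by rewrite cardP; nia.
Qed.

Lemma cone_triangle_free : triangle_free cone_graph.
Proof.
have blk (A : {A : {set H} | A \in P}) x y : x \in val A -> adj x y -> y \in val A -> False.
  by move=> xA xy yA; have /negP := indep (valP A) xA yA.
(* Computation leaves the triangles with one block and two of its elements, which independence
   excludes, and those inside [H]. *)
move=> [[A|x]|] [[B|y]|] [[C|z]|] //= => [Ay yz zA|xB zB zx|xy yC Cx|].
- exact: blk Ay yz zA.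
- exact: blk zB zx xB.
- exact: blk Cx xy yC.
exact: tf.
Qed.

Lemma cone_square_free : square_free cone_graph.
Proof.
(* Surviving cases by the opposite corners [x], [y]: two blocks (three cases), block and vertex of
   [H] in either order, two vertices of [H] (four cases), vertex of [H] and root in either order. *)
move=> [[A|x]|] [[B|y]|] [[C|z]|] [[D|t]|] //= ne.
- by move=> zA zB _ _; rewrite (block_inj zA zB) eqxx in ne.
- by move=> zA zB _ _; rewrite (block_inj zA zB) eqxx in ne.
- by move=> _ _ tA tB; rewrite (block_inj tA tB) eqxx in ne.
- move=> zA zy tA ty; congr (Some (inr _)).
  by apply: (block_nbr_inj (x := y) zA tA); rewrite adj_sym.
- by move=> xz zB xt tB; rewrite (block_nbr_inj zB tB xz xt).
- by move=> xC _ xD _; rewrite (block_inj xC xD).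
- move=> xC yC xt ty.
  by rewrite (block_nbr_inj xC yC (etrans (adj_sym _ _) xt) ty) eqxx in ne.
- move=> xz zy xD yD.
  by rewrite (block_nbr_inj xD yD (etrans (adj_sym _ _) xz) zy) eqxx in ne.
- by move=> xz zy xt ty; rewrite (sf _ xz zy xt ty) //; apply: contraNneq ne => ->.
- by move=> xC _ xD _; rewrite (block_inj xC xD).
by move=> _ yC _ yD; rewrite (block_inj yC yD).
Qed.

(** A block sees the root and its d - 1 elements, a vertex of [H] sees its block and d - 1 vertices
    of [H], and the root sees the [d] blocks. *)
Lemma cone_regular : regular cone_graph d.
Proof.
have inlI : injective (fun A => Some (inl A) : cone) by move=> A B [].
have inrI : injective (fun x => Some (inr x) : cone) by move=> A B [].
move=> [[A|x]|].
- rewrite /degree (cardsD1 None) inE /= -[RHS](subnKC (ltnW d_gt1)); congr (1 + _).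
  rewrite -[RHS](card_block (valP A)) -[RHS](card_imset _ inrI).
  apply: eq_card => a; rewrite !inE; apply/idP/imsetP => [|[y yA ->]] //=.
  by case: a => [[B|y]|] //= yA; exists y.
- have [A xA] := block_of x.
  rewrite /degree (cardsD1 (Some (inl A))) inE /= xA -[RHS](subnKC (ltnW d_gt1)); congr (1 + _).
  rewrite -[RHS](reg x) -[RHS](card_imset _ inrI).
  apply: eq_card => a; rewrite !inE; apply/idP/imsetP => [|[y xy ->]] /=; last by rewrite inE in xy.
  case: a => [[B|y]|] //=; last by exists y; rewrite ?inE.
  by case/andP=> /eqP BA xB; case: BA; rewrite (block_inj xA xB).
rewrite -[RHS]card_blocks -cardsT -[RHS](card_imset _ inlI).
apply: eq_card => a; rewrite !inE; apply/idP/imsetP => [|[A _ ->]] //=.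
by case: a => [[B|y]|] //= _; exists B.
Qed.

Lemma Moore_graph2_cone : Moore_graph2 cone_graph d.
Proof.
apply: (Moore_graph2_free (None : cone_graph)) => //.
- exact: cone_regular.
- exact: cone_triangle_free.
- exact: cone_square_free.
exact: regular_free_diameter cone_regular cone_triangle_free cone_square_free card_cone.
Qed.

End Cone.

Theorem theorem4 (d : nat) (hd : 2 <= d) :
  (exists G : sgraph, Moore_graph2 G d) <->
  (exists (H : sgraph) (P : {set {set H}}),
    [/\ [/\ partition P [set: H], #|P| = d &
            forall A : {set H}, A \in P ->
            forall x y : H, x \in A -> y \in A -> ~~ adj x y],
        forall A : {set H}, A \in P -> #|A| = d - 1,
        regular H (d - 1),
        forall A B : {set H}, A \in P -> B \in P -> A != B ->
        forall x : H, x \in A -> exists! y : H, y \in B /\ adj x y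
      & forall c : seq H, graph_cycle c -> size c <> 3 /\ size c <> 4]).
Proof.
split=> [[G [reg dm2 /girth5_free[tf sf]]] | [H [P [[partP cardP ind] cb reg mt]]]].
  (* Any vertex can serve as [r]; the pair realizing the diameter supplies one. *)
  have [_ [r _]] := dm2; have diam := diameter2_common dm2.
  exists (second_graph r), (parts r); split.
  - split; first exact: (partition_parts r hd reg tf sf diam).
      exact: (card_parts r hd reg tf sf).
    by move=> A /imsetP[u _ ->]; apply: (part_independent tf).
  - by move=> A /imsetP[u]; rewrite inE => ru ->; exact: (card_part reg tf).
  - exact: (second_regular (r := r) reg sf diam).
  - move=> A B /imsetP[u /[!inE] ru ->] /imsetP[v /[!inE] rv ->] uNv x.
    exact: (part_matching tf sf diam ru rv).
  by apply/no_short_cycleP; split;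
    [apply: second_triangle_free | apply: second_square_free].
case/no_short_cycleP=> tf sf.
by exists (cone_graph P); apply: Moore_graph2_cone.
Qed.
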